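(* For all integers $n\ge 2$, the Higman--Thompson groups $T_n$ and $V_n$ are non-inner amenable, i.e., neither $T_n$ nor $V_n$ is inner amenable.
   Context: A (discrete) group $G$ is inner amenable if there is a finitely additive probability measure on $G\setminus\{1\}$ (defined on all subsets) that is invariant under the conjugation action of $G$; it is non-inner amenable otherwise. For $n\ge 2$ let $\mathfrak{C}_n=\{1,\dots,n\}^{\mathbb{N}}$ be the $n$-ary Cantor set (infinite words in the alphabet $\{1,\dots,n\}$, with the product topology). For a finite word $w$ in the alphabet $\{1,\dots,n\}$, the cone of $w$ is $\mathfrak{C}_n(w)=\{w\kappa\mid \kappa\in\mathfrak{C}_n\}$. The Higman--Thompson group $V_n$ is the group (under composition) of all self-homeomorphisms of $\mathfrak{C}_n$ of the following form: take a partition of $\mathfrak{C}_n$ into finitely many cones $\mathfrak{C}_n(w_1),\dots,\mathfrak{C}_n(w_k)$ and another partition of $\mathfrak{C}_n$ into the same number of cones $\mathfrak{C}_n(v_1),\dots,\mathfrak{C}_n(v_k)$, and map each $\mathfrak{C}_n(w_i)$ onto some $\mathfrak{C}_n(v_j)$ (bijectively between the two sets of cones) via the prefix replacement map $w_i\kappa\mapsto v_j\kappa$. Order the words in each partition lexicographically, so $w_1<\cdots<w_k$ and $v_1<\cdots<v_k$. The Higman--Thompson group $T_n$ is the subgroup of $V_n$ consisting of all such homeomorphisms for which, for each $i$, if $\mathfrak{C}_n(w_i)$ maps to $\mathfrak{C}_n(v_j)$ then $\mathfrak{C}_n(w_{i+1})$ maps to $\mathfrak{C}_n(v_{j+1})$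 (subscripts modulo $k$). *)

(* Defs.v *)
From HB Require Import structures.
From mathcomp Require Import all_boot all_order all_algebra.
From mathcomp Require Import zify.
From mathcomp Require Import boolp classical_sets reals topology.

Set Implicit Arguments.
Unset Strict Implicit.
Unset Printing Implicit Defensive.

Import Order.TTheory.

Local Open Scope classical_set_scope.

Section InnerAmenability.
Local Open Scope ring_scope.

(* [mu] is only constrained on the subsets of [X]; its other values are
   irrelevant. *)
Definition finitely_additive_probability (R : realType) (T : Type)
    (X : set T) (mu : set T -> R) : Prop :=
  [/\ mu X = 1,
      forall A, A `<=` X -> 0 <= mu A &
      forall A B, A `<=` X -> B `<=` X -> A `&` B = set0 ->
        mu (A `|` B) = mu A + mu B].

Definition inner_amenable (R : realType) (G : groupType) : Prop :=
  exists mu : set G -> R,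
    finitely_additive_probability [set~ 1%g] mu /\
    forall (g : G) (A : set G), A `<=` [set~ 1%g] ->
      mu ((fun x => conjg x g) @` A) = mu A.

End InnerAmenability.

Section Homeomorphisms.
Variable X : topologicalType.

Record homeo := Homeo {
  homeo_fun :> X -> X;
  homeo_inv : X -> X;
  homeo_funK : cancel homeo_fun homeo_inv;
  homeo_invK : cancel homeo_inv homeo_fun;
  homeo_cts : continuous homeo_fun;
  homeo_inv_cts : continuous homeo_inv }.

HB.instance Definition _ := gen_eqMixin homeo.
HB.instance Definition _ := gen_choiceMixin homeo.

Lemma homeoP (f g : homeo) : f =1 g -> f = g.
Proof.
case: f g => [f f' fK f'K fc f'c] [g g' gK g'K gc g'c] /= /funext fg.
subst g; have f'g' : f' = g' by apply/funext => x; rewrite -{1}(g'K x) fK.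
subst g'; congr Homeo; exact: Prop_irrelevance.
Qed.

Fact id_continuous : continuous (@id X).
Proof. by move=> x; exact: cvg_id. Qed.

Definition homeo_id : homeo :=
  @Homeo id id (fun=> erefl) (fun=> erefl) id_continuous id_continuous.

Definition homeo_sym (f : homeo) : homeo :=
  Homeo (@homeo_invK f) (@homeo_funK f) (@homeo_inv_cts f) (@homeo_cts f).

Definition homeo_comp (f g : homeo) : homeo :=
  @Homeo (f \o g) (homeo_inv g \o homeo_inv f)
    (can_comp (@homeo_funK f) (@homeo_funK g))
    (can_comp (@homeo_invK g) (@homeo_invK f))
    (fun x => continuous_comp (@homeo_cts g x) (@homeo_cts f _))
    (fun x => continuous_comp (@homeo_inv_cts f x) (@homeo_inv_cts g _)).

Fact homeo_compA : associative homeo_comp.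
Proof. by move=> f g h; apply: homeoP. Qed.
Fact homeo_comp1f : left_id homeo_id homeo_comp.
Proof. by move=> f; apply: homeoP. Qed.
Fact homeo_compf1 : right_id homeo_id homeo_comp.
Proof. by move=> f; apply: homeoP. Qed.
Fact homeo_compVf : left_inverse homeo_id homeo_sym homeo_comp.
Proof. by move=> f; apply: homeoP => x /=; rewrite homeo_funK. Qed.
Fact homeo_compfV : right_inverse homeo_id homeo_sym homeo_comp.
Proof. by move=> f; apply: homeoP => x /=; rewrite homeo_invK. Qed.

HB.instance Definition _ := isGroup.Build homeo
  homeo_compA homeo_comp1f homeo_compf1 homeo_compVf homeo_compfV.

End Homeomorphisms.

(* The alphabet is {0, ..., n-1}. *)
Definition cantor (n : nat) : topologicalType :=
  {ptws nat -> discrete_topology 'I_n}.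

Section Words.
Variable n : nat.
Implicit Types (w u v : seq 'I_n) (x y z : cantor n).

(* The infinite word [w x]: the default value of [nth] supplies the letters
   past the end of [w]. *)
Definition prepend w x : cantor n := fun i => nth (x (i - size w)) w i.

Definition cone w : set (cantor n) := range (prepend w).

Definition cone_partition k (w : 'I_k -> seq 'I_n) : Prop :=
  \bigcup_i cone (w i) = setT /\ trivIset setT (fun i => cone (w i)).

(* [f] maps the cone of [w i] onto the cone of [v (s i)] by prefix
   replacement, [s] being a bijection between the two sets of cones. *)
Definition prefix_replacement k (w v : 'I_k -> seq 'I_n) (s : 'I_k -> 'I_k)
    (f : cantor n -> cantor n) : Prop :=
  [/\ cone_partition w, cone_partition v, bijective s &
      forall i x, f (prepend (w i) x) = prepend (v (s i)) x].

Definition lex_increasing k (w : 'I_k -> seq 'I_n) : Prop :=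
  forall i j : 'I_k, (i < j)%N -> ((w i : seqlexi 'I_n) < w j)%O.

Definition in_V : {pred homeo (cantor n)} := fun f =>
  `[< exists k (w v : 'I_k -> seq 'I_n) (s : 'I_k -> 'I_k),
        prefix_replacement w v s f >].

(* [ordS] is the successor modulo [k] on ['I_k]. *)
Definition in_T : {pred homeo (cantor n)} := fun f =>
  `[< exists k (w v : 'I_k -> seq 'I_n) (s : 'I_k -> 'I_k),
        [/\ prefix_replacement w v s f, lex_increasing w, lex_increasing v &
            forall i, s (ordS i) = ordS (s i)] >].

(* The rest of this section proves that [in_V] and [in_T] are subgroups.
   Elements of V are characterized by finite covers by cones on which they act
   by prefix replacement, and T consists of the elements of V that preserve
   the cyclic order. *)

Lemma prepend_cat w u x : prepend (w ++ u) x = prepend w (prepend u x).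
Proof.
apply/funext => i; rewrite /prepend nth_cat size_cat.
case: ltnP => [iw|wi]; first exact: set_nth_default.
by rewrite [RHS]nth_default // subnDA.
Qed.

Lemma prepend0 x : prepend [::] x = x.
Proof. by apply/funext => i; rewrite /prepend nth_nil subn0. Qed.

Lemma prepend_inj w : injective (prepend w).
Proof.
move=> x y e; apply/funext => i.
have := congr1 (fun f : cantor n => f (size w + i)) e.
by rewrite /prepend !nth_default ?leq_addr // addKn.
Qed.

Lemma prepend_prefix w u x y : prepend w x = prepend u y ->
  (size w <= size u)%N -> exists v, u = w ++ v.
Proof.
move=> e le; exists (drop (size w) u).
rewrite -{1}(cat_take_drop (size w) u); congr (_ ++ _).
apply: (@eq_from_nth _ (x 0)); rewrite size_takel // => i iw.
have := congr1 (fun f : cantor n => f i) e.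
rewrite nth_take // /prepend (set_nth_default (x 0) _ iw).
by rewrite [RHS](set_nth_default (x 0)) //; exact: leq_trans iw le.
Qed.

Lemma prepend_comparable w u x y : prepend w x = prepend u y ->
  (exists v, u = w ++ v) \/ (exists v, w = u ++ v).
Proof.
move=> e; case: (leqP (size w) (size u)) => [|/ltnW] le.
  by left; exact: prepend_prefix e le.
by right; exact: prepend_prefix (esym e) le.
Qed.

Definition table (f : cantor n -> cantor n) (L : seq (seq 'I_n * seq 'I_n)) :=
  (forall x, exists2 p, p \in L & cone p.1 x) /\
  (forall p, p \in L -> forall x, f (prepend p.1 x) = prepend p.2 x).

Lemma in_V_table f : f \in in_V -> exists L, table f L.
Proof.
move=> /asboolP [k [w [v [s [[cw _] _ _ fwv]]]]].
exists [seq (w i, v (s i)) | i <- enum 'I_k]; split.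
  move=> x; have [i _ wix] : (\bigcup_i cone (w i)) x by rewrite cw.
  by exists (w i, v (s i)) => //; apply: map_f; rewrite mem_enum.
by move=> p /mapP [i _ ->] x; exact: fwv.
Qed.

Lemma lexi_total : total (fun u v : seq 'I_n => (u : seqlexi 'I_n) <= v)%O.
Proof. by move=> u v; exact: le_total. Qed.

Definition lsort (s : seq (seq 'I_n)) :=
  sort (fun u v : seq 'I_n => (u : seqlexi 'I_n) <= v)%O s.

Lemma lsort_lt (s : seq (seq 'I_n)) i j : uniq s -> (i < j < size s)%N ->
  ((nth [::] (lsort s) i : seqlexi 'I_n) < nth [::] (lsort s) j)%O.
Proof.
move=> us /andP [ij js].
have srt : sorted (fun u v : seq 'I_n => (u : seqlexi 'I_n) <= v)%O (lsort s).
  exact: sort_sorted lexi_total _.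
have us' : uniq (lsort s) by rewrite /lsort sort_uniq.
rewrite lt_neqAle; apply/andP; split.
  by rewrite nth_uniq ?size_sort // ?(ltn_trans ij) // neq_ltn ij.
apply: (sorted_ltn_nth _ _ srt) => //; last 2 first.
- by rewrite inE size_sort (ltn_trans ij).
- by rewrite inE size_sort.
by move=> u v t; exact: (@le_trans _ (seqlexi 'I_n)).
Qed.


(* A finite cover by cones can be cut down to its minimal words. *)

(* A finite cover by cones can be cut down to its minimal words. *)

(* A finite cover by cones can be cut down to its minimal words. *)

(* A finite cover by cones can be cut down to its minimal words. *)

(* A finite cover by cones can be cut down to its minimal words. *)

(* A finite cover by cones can be cut down to its minimal words. *)

(* A finite cover by cones can be cut down to its minimal words. *)

(* A finite cover by cones can be cut down to its minimal words. *)
Lemma table_sorted (f : homeo (cantor n)) L : (0 < n)%N -> table f L ->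
  exists k (w v : 'I_k -> seq 'I_n) (s : 'I_k -> 'I_k),
    [/\ prefix_replacement w v s f, lex_increasing w & lex_increasing v].
Proof.
move=> n0 [cov act]; pose x0 : cantor n := fun=> Ordinal n0.
pose U := unzip1 L.
pose W0 := [seq w <- undup U | all (fun u => prefix u w ==> (u == w)) U].
have [im imP] : {im & forall w, w \in W0 ->
    forall x, f (prepend w x) = prepend (im w) x}.
  apply: (@choice _ _ (fun w v => w \in W0 ->
    forall x, f (prepend w x) = prepend v x)) => w.
  case: (boolP (w \in W0)) => [|_]; last by exists [::].
  rewrite mem_filter mem_undup => /andP [_ /mapP [p pL ->]].
  by exists p.2 => _ x; exact: act.
have disj w u x y : w \in W0 -> u \in W0 -> prepend w x = prepend u y -> w = u.
  rewrite !mem_filter !mem_undup => /andP [/allP mw wU] /andP [/allP mu uU] e.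
  case: (prepend_comparable e) => [[t tE]|[t tE]].
    by have /implyP := mu _ wU; rewrite tE prefix_prefix -tE => /(_ isT) /eqP.
  by have /implyP := mw _ uU; rewrite tE prefix_prefix -tE => /(_ isT) /eqP.
have covW x : exists2 w, w \in W0 & cone w x.
  have [p pL px] := cov x.
  have : exists m, has (fun u => (size u == m) && prefix u p.1) U.
    exists (size p.1); apply/hasP; exists p.1; first exact: map_f.
    by rewrite eqxx prefix_refl.
  move=> /ex_minnP [m /hasP [u uU /andP [/eqP um up]] mmin].
  exists u; last first.
    move: up px => /prefixP [t ->] [y _ <-].
    by rewrite prepend_cat; exists (prepend t y).
  rewrite mem_filter mem_undup uU andbT; apply/allP => t tU.
  apply/implyP => tu; have : (m <= size t)%N.
    apply: mmin; apply/hasP; exists t => //; rewrite eqxx /=.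
    exact: prefix_trans tu up.
  move: tu => /prefixP [r rE]; rewrite -um rE size_cat -{2}[size t]addn0 leq_add2l.
  by rewrite leqn0 size_eq0 => /eqP ->; rewrite cats0.
have uW : uniq W0 by rewrite filter_uniq // undup_uniq.
have disjv w u x y : w \in W0 -> u \in W0 ->
    prepend (im w) x = prepend (im u) y -> w = u.
  move=> wW uW'; rewrite -imP // -imP // => /(can_inj (@homeo_funK _ f)).
  exact: disj.
pose V0 := map im W0.
have uV : uniq V0.
  rewrite map_inj_in_uniq // => w u wW uW' e.
  by apply: (disjv _ _ x0 x0) => //; rewrite e.
pose W := lsort W0; pose V := lsort V0; pose k := size W0.
have sW : size W = k by rewrite size_sort.
have sV : size V = k by rewrite size_sort size_map.
have memW (i : 'I_k) : nth [::] W i \in W0.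
  by rewrite -(mem_sort (fun u v : seq 'I_n => (u : seqlexi 'I_n) <= v)%O)
    mem_nth // sW.
have memV (i : 'I_k) : im (nth [::] W i) \in V.
  by rewrite mem_sort map_f.
pose w (i : 'I_k) := nth [::] W i; pose v (i : 'I_k) := nth [::] V i.
have sP (i : 'I_k) : (index (im (w i)) V < k)%N by rewrite -[X in (_ < X)%N]sV index_mem memV.
pose s (i : 'I_k) := Ordinal (sP i).
have vs i : v (s i) = im (w i) by rewrite /v /s /= nth_index ?memV.
have winj : injective w.
  move=> i j /eqP; rewrite nth_uniq ?sW // ?sort_uniq // => /eqP.
  exact: val_inj.
have vinj : injective v.
  move=> i j /eqP; rewrite nth_uniq ?sV // ?sort_uniq // => /eqP.
  exact: val_inj.
have sinj : injective s.
  move=> i j e; apply: winj; apply: (disjv _ _ x0 x0); rewrite ?memW //.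
  by rewrite -!vs e.
have sbij := injF_bij sinj.
have fwv i x : f (prepend (w i) x) = prepend (v (s i)) x by rewrite vs imP //; exact: memW.
exists k, w, v, s; split; last 2 first.
- by move=> i j ij; apply: lsort_lt => //; rewrite ij ltn_ord.
- by move=> i j ij; apply: lsort_lt => //; rewrite ij size_map ltn_ord.
split=> //; split.
- apply/seteqP; split=> // x _; have [u uW' ux] := covW x.
  have uk : (index u W < k)%N by rewrite -sW index_mem mem_sort.
  exists (Ordinal uk) => //; rewrite /w /= nth_index ?mem_sort //.
- move=> i j _ _ [x [[y _ <-] [z _ e]]]; apply: winj.
  by apply: disj (esym e); exact: memW.
- apply/seteqP; split=> // x _.
  have [u uW' [y _ uy]] := covW (homeo_inv f x).
  have uk : (index u W < k)%N by rewrite -sW index_mem mem_sort.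
  exists (s (Ordinal uk)) => //; exists y => //.
  by rewrite -fwv /w /= nth_index ?mem_sort // uy homeo_invK.
- move=> i j _ _ [x [[y _ <-] [z _ e]]].
  case: sbij => s' _ ss'; rewrite -(ss' i) -(ss' j); congr (s _).
  apply: winj; move: e; rewrite -{1}(ss' i) -{1}(ss' j) !vs => e.
  by apply: disjv (esym e); exact: memW.
Qed.

Lemma in_V0 (f : homeo (cantor n)) : n = 0%N -> f = 1%g.
Proof. by move=> n0; apply: homeoP => x; have := ltn_ord (x 0%N : 'I_n); rewrite {2}n0. Qed.

Lemma table_in_V (f : homeo (cantor n)) L : (0 < n)%N -> table f L -> f \in in_V.
Proof.
move=> n0 /(table_sorted n0) [k [w [v [s [h _ _]]]]].
by apply/asboolP; exists k, w, v, s.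
Qed.

Lemma prefix_replacement1 :
  @prefix_replacement 1 (fun=> [::]) (fun=> [::]) id (1%g : homeo (cantor n)).
Proof.
have p : @cone_partition 1 (fun=> [::]).
  split; first by apply/seteqP; split=> // x _; exists ord0 => //; exists x => //;
    rewrite prepend0.
  by move=> i j _ _ _; rewrite (ord1 i) (ord1 j).
by split=> //; exists id.
Qed.

Lemma prefix_replacementV k (w v : 'I_k -> seq 'I_n) s s' (f : homeo (cantor n)) :
  cancel s s' -> cancel s' s -> prefix_replacement w v s f ->
  prefix_replacement v w s' (f^-1)%g.
Proof.
move=> sK s'K [pw pv _ fwv]; split=> //; first by exists s.
move=> i x; apply: (can_inj (@homeo_funK _ f)).
by rewrite fwv s'K -[LHS]/(f (homeo_inv f _)) homeo_invK.
Qed.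

Lemma in_V1 : 1%g \in in_V.
Proof.
by apply/asboolP; exists 1%N, (fun=> [::]), (fun=> [::]), id;
  exact: prefix_replacement1.
Qed.

Lemma in_VV f : f \in in_V -> (f^-1)%g \in in_V.
Proof.
move=> /asboolP [k [w [v [s h]]]]; case: (h) => _ _ [s' sK s'K] _.
by apply/asboolP; exists k, v, w, s'; exact: prefix_replacementV h.
Qed.

Lemma in_VM f g : f \in in_V -> g \in in_V -> (f * g)%g \in in_V.
Proof.
case: (posnP n) => [n0|n0 /in_V_table [Lf [cf af]] /in_V_table [Lg [cg ag]]].
  by rewrite (in_V0 f n0) (in_V0 g n0) mulg1.
pose cmb (pq : (seq 'I_n * seq 'I_n) * (seq 'I_n * seq 'I_n)) :=
  let: (p, q) := pq in
  if prefix q.1 p.2 then [:: (p.1, q.2 ++ drop (size q.1) p.2)]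
  else if prefix p.2 q.1 then [:: (p.1 ++ drop (size p.2) q.1, q.2)] else [::].
apply: (@table_in_V _ (flatten [seq cmb pq | pq <- [seq (p, q) | p <- Lg, q <- Lf]]) n0).
split=> [x|r].
  have [p pL [y _ py]] := cg x; have [q qL [z _ qz]] := cf (g x).
  have e : prepend p.2 y = prepend q.1 z by rewrite -ag // py qz.
  have inL r : r \in cmb (p, q) ->
      r \in flatten [seq cmb pq | pq <- [seq (p, q) | p <- Lg, q <- Lf]].
    move=> rpq; apply/flattenP; exists (cmb (p, q)) => //; apply: map_f.
    exact: allpairs_f.
  case: (boolP (prefix q.1 p.2)) => qp.
    exists (p.1, q.2 ++ drop (size q.1) p.2); last by exists y.
    by apply: inL; rewrite /cmb qp mem_head.
  case: (boolP (prefix p.2 q.1)) => pq.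
    exists (p.1 ++ drop (size p.2) q.1, q.2).
      by apply: inL; rewrite /cmb (negbTE qp) pq mem_head.
    exists z => //=; move: (pq) e => /prefixP [t tE].
    rewrite tE drop_size_cat // !prepend_cat => /prepend_inj <-; exact: py.
  case: (prepend_comparable e) => -[t tE]; [move: pq|move: qp];
    by rewrite tE prefix_prefix.
move=> /flattenP [_ /mapP [_ /allpairsP [[p q] /= [pL qL ->]] ->]] /=.
case: ifP => [/prefixP [t tE]|_].
  rewrite inE => /eqP -> x /=.
  by rewrite ag // tE drop_size_cat // !prepend_cat af.
case: ifP => [/prefixP [t tE]|//].
rewrite inE => /eqP -> x /=.
by rewrite -af // -[LHS]/(f (g _)) tE drop_size_cat // !prepend_cat ag.
Qed.

Fact in_V_group : group_closed in_V.
Proof.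
by split=> [|f g fV gV]; [exact: in_V1|exact/in_VM/in_VV].
Qed.

Definition ltc x y :=
  exists2 m, (forall i, (i < m)%N -> x i = y i) & ((x m : 'I_n) < (y m : 'I_n))%N.

Definition cyc x y z :=
  [\/ ltc x y /\ ltc y z, ltc y z /\ ltc z x | ltc z x /\ ltc x y].

Lemma ltc_trans x y z : ltc x y -> ltc y z -> ltc x z.
Proof.
move=> [m em lm] [p ep lp]; exists (minn m p) => [i|].
  by rewrite leq_min => /andP [im ip]; rewrite em // ep.
case: (ltngtP m p) => [mp|pm|mp]; first by rewrite -ep.
  by rewrite em.
by subst p; exact: ltn_trans lm lp.
Qed.

Lemma ltc_irr x : ~ ltc x x.
Proof. by move=> [m _]; rewrite ltnn. Qed.

Lemma ltc_prepend w x y : ltc (prepend w x) (prepend w y) <-> ltc x y.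
Proof.
split=> -[m em lm].
  case: (ltnP m (size w)) => [mw|wm].
    by move: lm; rewrite /prepend (set_nth_default (y (m - size w)%N)) // ltnn.
  exists (m - size w)%N => [i im|]; last first.
    by move: lm; rewrite /prepend !nth_default.
  have /em : (size w + i < m)%N by lia.
  by rewrite /prepend !nth_default ?leq_addr // addKn.
exists (size w + m)%N => [i im|]; last first.
  by rewrite /prepend !nth_default ?leq_addr // addKn.
rewrite /prepend; case: (ltnP i (size w)) => wi; first exact: set_nth_default.
by rewrite !nth_default // em //; lia.
Qed.

Lemma ltc_lexi (w u : seq 'I_n) x y : ((w : seqlexi 'I_n) < u)%O ->
  (forall t, u <> w ++ t) -> ltc (prepend w x) (prepend u y).
Proof.
elim: w u => [|a w IH] [|b u] //; first by move=> _ /(_ (b :: u)).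
rewrite ltxi_cons => /andP [ab ba] nt.
case: (eqVneq a b) => [e|nab]; last first.
  exists 0%N => //; rewrite /prepend /=.
  by have : (a < b)%O by rewrite lt_neqAle nab.
subst b; rewrite -[a :: w]cat1s -[a :: u]cat1s !prepend_cat; apply/ltc_prepend.
apply: IH; first by move: ba; rewrite lexx.
by move=> t e; apply: (nt t); rewrite e.
Qed.

Section Tables.
Variables (k : nat) (w : 'I_k -> seq 'I_n).
Hypotheses (pw : cone_partition w) (lw : lex_increasing w).

Lemma cone_ltc (i j : 'I_k) x y : (i < j)%N -> ltc (prepend (w i) x) (prepend (w j) y).
Proof.
move=> ij; apply: ltc_lexi; first exact: lw.
move=> t e; have : i = j.
  case: pw => _ /(_ i j I I); apply; exists (prepend (w j) y); split.
    by rewrite e prepend_cat; exists (prepend t y).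
  by exists y.
by move=> eij; rewrite eij ltnn in ij.
Qed.

Lemma ltc_cone i j x y : ltc (prepend (w i) x) (prepend (w j) y) ->
  (i < j)%N \/ i = j /\ ltc x y.
Proof.
case: (ltngtP i j) => [ij|ji|/val_inj e] xy; first by left.
  by case: (@ltc_irr (prepend (w i) x)); exact: ltc_trans xy (cone_ltc y x ji).
by subst j; right; split=> //; move/ltc_prepend: xy.
Qed.

Lemma cone_cover x : exists i y, x = prepend (w i) y.
Proof.
have [i _ [y _ <-]] : (\bigcup_i cone (w i)) x by case: pw => ->.
by exists i, y.
Qed.

Lemma cyc_next (j l : 'I_k) x : l != j -> l != ordS j ->
  cyc (prepend (w j) x) (prepend (w (ordS j)) x) (prepend (w l) x).
Proof.
move=> lj lSj; have {}lj : (l != j :> nat) by [].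
have {}lSj : (l != j.+1 %% k :> nat) by [].
have jk := ltn_ord j; have lk := ltn_ord l.
have jS : (ordS j : nat) = (j.+1 %% k)%N by [].
case: (ltngtP j.+1 k) jk => // [jk _|jk _].
  rewrite modn_small // in lSj jS.
  case: (ltngtP l j) lj => // {}lj _.
    by apply: Or33; split; apply: cone_ltc; lia.
  by apply: Or31; split; apply: cone_ltc; lia.
rewrite jk modnn in lSj jS.
by apply: Or32; split; apply: cone_ltc; lia.
Qed.

End Tables.

Lemma cyc_asym x y z : cyc x y z -> cyc x z y -> False.
Proof.
have T := ltc_trans; have N a b : ltc a b -> ltc b a -> False.
  by move=> ab ba; apply: (@ltc_irr a); exact: T ab ba.
by move=> [] [] a b [] [] c d; first
  [exact: (N _ _ a d)|exact: (N _ _ a c)|exact: (N _ _ b d)|exact: (N _ _ b c)].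
Qed.

Lemma ordS_shift k (s : 'I_k -> 'I_k) : (forall i, s (ordS i) = ordS (s i)) ->
  exists2 c, (c < k)%N \/ k = 0%N & forall i : 'I_k,
    (i + c < k)%N /\ s i = (i + c)%N :> nat \/
    (k <= i + c)%N /\ s i = (i + c - k)%N :> nat.
Proof.
case: k s => [|k] s sS; first by exists 0%N; [right|case].
exists (s ord0 : nat); first by left; exact: ltn_ord.
have H m (mk : (m < k.+1)%N) : s (Ordinal mk) = ((m + s ord0) %% k.+1)%N :> nat.
  elim: m mk => [|m IH] mk.
    by rewrite add0n modn_small //; congr (nat_of_ord (s _)); exact: val_inj.
  have -> : Ordinal mk = ordS (Ordinal (ltnW mk)).
    by apply: val_inj => /=; rewrite modn_small.
  by rewrite sS /= IH -addn1 modnDml addn1 addSn.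
move=> i; have := H _ (ltn_ord i).
have -> : Ordinal (ltn_ord i) = i by exact: val_inj.
have ik := ltn_ord i; have sk := ltn_ord (s ord0).
case: (ltnP (i + s ord0) k.+1) => h e; [left|right]; split=> //.
  by rewrite e modn_small.
rewrite e -{1}(subnK h) modnDr modn_small //; lia.
Qed.

Lemma T_cyc k (w v : 'I_k -> seq 'I_n) s f : prefix_replacement w v s f ->
  lex_increasing w -> lex_increasing v -> (forall i, s (ordS i) = ordS (s i)) ->
  forall x y z, cyc x y z -> cyc (f x) (f y) (f z).
Proof.
move=> [pw pv _ fwv] lw lv /ordS_shift [c ck sE].
suff H x y z : ltc x y -> ltc y z -> cyc (f x) (f y) (f z).
  move=> x y z [] [a b]; first exact: H.
    by case: (H _ _ _ a b) => h; [apply: Or32|apply: Or33|apply: Or31].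
  by case: (H _ _ _ a b) => h; [apply: Or33|apply: Or31|apply: Or32].
have [i [x' ->]] := cone_cover pw x.
have [j [y' ->]] := cone_cover pw y.
have [l [z' ->]] := cone_cover pw z.
have L (a b : 'I_k) p q : (s a < s b)%N \/ a = b /\ ltc p q ->
    ltc (prepend (v (s a)) p) (prepend (v (s b)) q).
  by move=> [|[-> pq]]; [exact: cone_ltc|apply/ltc_prepend].
move=> /(ltc_cone pw lw) ij /(ltc_cone pw lw) jl; rewrite !fwv.
have si := ltn_ord (s i); have sj := ltn_ord (s j); have sl := ltn_ord (s l).
have ii := ltn_ord i; have jj := ltn_ord j; have ll := ltn_ord l.
have := sE i; have := sE j; have := sE l; case: ij jl => [ij|[ij xy]] [jl|[jl yz]].
- move=> hl hj hi.
  have : [\/ (s i < s j < s l)%N, (s j < s l < s i)%N | (s l < s i < s j)%N].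
    case: hl hj hi => -[hl el] [] [hj ej] [] [hi ei]; rewrite el ej ei;
      by [exfalso; lia|apply: Or31; lia|apply: Or32; lia|apply: Or33; lia].
  by case=> /andP [h1 h2]; [apply: Or31|apply: Or32|apply: Or33];
    split; apply: L; left.
- subst l => _ hj hi; have : (s i < s j)%N \/ (s j < s i)%N.
    by case: hj hi => -[hj ej] [] [hi ei]; lia.
  by case=> h; [apply: Or31|apply: Or32]; split; apply: L; auto.
- subst j => hl _ hi; have : (s i < s l)%N \/ (s l < s i)%N.
    by case: hl hi => -[hj ej] [] [hi ei]; lia.
  by case=> h; [apply: Or31|apply: Or33]; split; apply: L; auto.
- by subst j l => _ _ _; apply: Or31; split; apply: L; auto.
Qed.

Lemma cyc_T k (w v : 'I_k -> seq 'I_n) s f : (0 < n)%N ->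
  prefix_replacement w v s f -> lex_increasing w -> lex_increasing v ->
  (forall x y z, cyc x y z -> cyc (f x) (f y) (f z)) ->
  forall i, s (ordS i) = ordS (s i).
Proof.
move=> n0 [pw pv [s' sK s'K] fwv] lw lv H i.
pose x : cantor n := fun=> Ordinal n0.
apply/eqP/negP => /negP ne.
have kS (a b : 'I_k) : ordS a = a -> b = a.
  move=> /(congr1 (@nat_of_ord k)) /= e; apply: val_inj => /=.
  have ak := ltn_ord a; have bk := ltn_ord b.
  case: (ltngtP a.+1 k) ak => // [ak|ak] _; first by rewrite modn_small // in e; lia.
  by rewrite ak modnn in e; lia.
have nS (a b : 'I_k) : a != b -> ordS a != a.
  by move=> ab; apply: contra_neq ab => e; rewrite (kS _ b e).
have nji : s (ordS i) != s i.
  apply: contra_neq ne => e; have {}e := can_inj sK e.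
  by rewrite (kS _ (s (ordS i)) e) (kS _ (ordS (s i)) e).
pose l := s' (ordS (s i)).
have sl : s l = ordS (s i) by rewrite /l s'K.
have li : l != i.
  rewrite eq_sym in nji.
  by apply: contra_neq (nS _ _ nji) => e; rewrite -sl e.
have lSi : l != ordS i by apply: contra_neq ne => e; rewrite -sl e.
have := H _ _ _ (cyc_next pw lw x li lSi); rewrite !fwv sl => h.
exact: cyc_asym h (cyc_next pv lv x nji ne).
Qed.

Lemma in_TP f : (0 < n)%N ->
  f \in in_T <-> f \in in_V /\ forall x y z, cyc x y z -> cyc (f x) (f y) (f z).
Proof.
move=> n0; split=> [/asboolP [k [w [v [s [h lw lv sS]]]]]|].
  by split; [apply/asboolP; exists k, w, v, s|exact: T_cyc h lw lv sS].
move=> [/in_V_table [L /(table_sorted n0) [k [w [v [s [h lw lv]]]]]] H].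
by apply/asboolP; exists k, w, v, s; split=> //; exact: cyc_T h lw lv H.
Qed.

Lemma in_T1 : 1%g \in in_T.
Proof.
apply/asboolP; exists 1%N, (fun=> [::]), (fun=> [::]), id.
by split=> //; [exact: prefix_replacement1| |] => i j; rewrite (ord1 i) (ord1 j).
Qed.

Lemma in_TV f : f \in in_T -> (f^-1)%g \in in_T.
Proof.
move=> /asboolP [k [w [v [s [h lw lv sS]]]]]; case: (h) => _ _ [s' sK s'K] _.
apply/asboolP; exists k, v, w, s'; split=> //; first exact: prefix_replacementV h.
by move=> i; apply: (can_inj sK); rewrite sS !s'K.
Qed.

Lemma in_TM f g : f \in in_T -> g \in in_T -> (f * g)%g \in in_T.
Proof.
case: (posnP n) => [n0|n0]; first by rewrite (in_V0 f n0) (in_V0 g n0) mulg1.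
move=> /(in_TP _ n0) [fV fc] /(in_TP _ n0) [gV gc]; apply/(in_TP _ n0).
by split=> [|x y z xyz]; [exact: in_VM|exact/fc/gc].
Qed.

Fact in_T_group : group_closed in_T.
Proof.
by split=> [|f g fT gT]; [exact: in_T1|exact/in_TM/in_TV].
Qed.

End Words.

Definition HT_V (n : nat) : Type := {f : homeo (cantor n) | f \in @in_V n}.
Definition HT_T (n : nat) : Type := {f : homeo (cantor n) | f \in @in_T n}.

HB.instance Definition _ n := [isSub of HT_V n for @sval _ _].
HB.instance Definition _ n := [Choice of HT_V n by <:].
HB.instance Definition _ n :=
  SubChoice_isSubGroup.Build _ _ (HT_V n) (@in_V_group n).
HB.instance Definition _ n := [isSub of HT_T n for @sval _ _].
HB.instance Definition _ n := [Choice of HT_T n by <:].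
HB.instance Definition _ n :=
  SubChoice_isSubGroup.Build _ _ (HT_T n) (@in_T_group n).

(* Main.v *)
Require Import Defs.
From mathcomp Require Import all_boot all_order all_algebra.
From mathcomp Require Import zify lra.
From mathcomp Require Import boolp classical_sets reals topology.
From mathcomp Require Import function_spaces.

(** The proof finds a nonabelian free group acting on the Cantor set by
    ping-pong inside T_n, and pushes a conjugation-invariant mean on the
    nontrivial elements of T_n or V_n forward to the Cantor set, where no mean
    is invariant under that free group.

    Generators.  Fix four disjoint cones, one for each of the letters
    a, a^-1, b, b^-1.  There are elements a and b of T_n such that every letter
    x maps the complement of the cone of x^-1 into the cone of x, and maps the
    cone of every letter other than x^-1 by prefix replacement to a proper
    subcone of the cone of x ([free_generators_exist]).  Hence a cyclically
    reduced word h has north-south dynamics: it contracts the cone of some word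
    u, and all forward orbits except that of one point q enter this cone
    ([cyclically_reduced_north_south]).

    Centralizers.  Let g be a nontrivial element of V_n commuting with such an
    h, and let p be the attracting point of h.  Since g acts near p by prefix
    replacement, it carries a small contracted cone of h around p to another
    contracted cone of h, which again contains p.  If the two cones are equal,
    then g is the identity on a neighbourhood of p that absorbs every orbit of
    h but one, so g is trivial.  Otherwise g or its inverse contracts the
    larger of the two cones and has north-south dynamics itself, attracted by
    p; so everything in V_n commuting with g fixes p
    ([centralizer_fixpoint]).  As every word in a and b is trivial or conjugate
    to a cyclically reduced one, the words that commute with a given nontrivial
    g have a common fixed point ([free_centralizer_fixpoint]).

    Conclusion.  Choosing one g in each conjugation orbit of the subgroup
    generated by a and b, and a fixed point of its stabilizer, defines an
    equivariant map from the nontrivial elements to the Cantor set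
    ([equivariant_selection]).  For a letter x, let E_x be the preimage of the
    cone of x.  Conjugation by x moves the complement of E_(x^-1) into E_x, so
    an invariant mean gives E_x and E_(x^-1) total mass at least 1.  Taking
    x = a and x = b, four disjoint sets get total mass at least 2
    ([ping_pong_not_inner_amenable]). *)

Set Implicit Arguments.
Unset Strict Implicit.
Unset Printing Implicit Defensive.

Import Order.TTheory GRing.Theory Num.Theory.

Local Open Scope classical_set_scope.

(** * North-south dynamics of prefix replacements *)

Section Dynamics.
Variable n : nat.
Hypothesis n_gt1 : 1 < n.
Implicit Types (u v w e s t r : seq 'I_n) (x y p q : cantor n).
Implicit Types (f g h : cantor n -> cantor n).

Definition pow_word e N := flatten (nseq N e).

Lemma size_pow_word e N : size (pow_word e N) = N * size e.
Proof. by rewrite size_flatten /shape map_nseq sumn_nseq mulnC. Qed.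

Lemma leq_size_pow_word e N : e <> [::] -> N <= size (pow_word e N).
Proof. by case: e => // a e _; rewrite size_pow_word leq_pmulr. Qed.

Lemma pow_wordD e M N : pow_word e (M + N) = pow_word e M ++ pow_word e N.
Proof. by rewrite /pow_word nseqD flatten_cat. Qed.

Lemma pow_wordSr e N : pow_word e N.+1 = pow_word e N ++ e.
Proof. by rewrite -addn1 pow_wordD /pow_word /= cats0. Qed.

Lemma prepend_nth w x i a : i < size w -> prepend w x i = nth a w i.
Proof. by move=> iw; rewrite /prepend; exact: set_nth_default. Qed.

Lemma cone_cat u v x : cone (u ++ v) x -> cone u x.
Proof. by move=> [y _ <-]; exists (prepend v y); rewrite // prepend_cat. Qed.

Lemma cone_comparable u v x : cone u x -> cone v x -> size u <= size v ->
  exists t, v = u ++ t.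
Proof. by move=> [y _ <-] [z _ e]; exact: prepend_prefix (esym e). Qed.

Lemma cone_disjoint u v x : size u = size v -> cone u x -> cone v x -> u = v.
Proof.
move=> suv ux vx; have [|t vE] := cone_comparable ux vx; first by rewrite suv.
move: suv; rewrite vE size_cat -[LHS]addn0 => /addnI /esym /size0nil ->.
by rewrite cats0.
Qed.

Lemma cone_separated x y :
  (forall N, exists2 u, N <= size u & cone u x /\ cone u y) -> x = y.
Proof.
move=> H; apply/funext => i; have [u iu [[x' _ <-] [y' _ <-]]] := H i.+1.
by rewrite (prepend_nth _ (x' 0) iu) (prepend_nth _ (x' 0) iu).
Qed.

Lemma two_points x : exists y, y <> x.
Proof.
pose c (b : bool) : cantor n := fun=> Ordinal (leq_ltn_trans (leq_b1 b) n_gt1).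
case: (pselect (c true = x)) => [<-|]; last by exists (c true).
by exists (c false) => /(congr1 (fun f : cantor n => nat_of_ord (f 0))).
Qed.

Lemma periodic_point e : e <> [::] -> exists z, prepend e z = z.
Proof.
case: e => // a e _; pose z : cantor n := fun i => nth a (a :: e) (i %% (size e).+1).
exists z; apply/funext => i; case: (ltnP i (size (a :: e))) => ie.
  by rewrite (prepend_nth _ a ie) /z modn_small.
by rewrite /prepend nth_default // /z /= -{2}(subnK ie) modnDr.
Qed.

Definition replaces h u v := forall k, h (prepend u k) = prepend v k.

Definition contracts h u e := replaces h u (u ++ e).

Definition commutes f g := forall x, f (g x) = g (f x).

Lemma iter_commutes f g M N x : commutes f g ->
  iter M f (iter N g x) = iter N g (iter M f x).
Proof.
move=> fg; have fNg y : f (iter N g y) = iter N g (f y).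
  by elim: N => //= N <-; rewrite fg.
by elim: M => //= M ->.
Qed.

Section Contraction.
Variables (h : cantor n -> cantor n) (u e : seq 'I_n).
Hypotheses (e0 : e <> [::]) (hue : contracts h u e).

Lemma iter_contracts N k :
  iter N h (prepend u k) = prepend (u ++ pow_word e N) k.
Proof.
elim: N k => [|N IH] k; first by rewrite cats0.
by rewrite iterSr hue prepend_cat IH -prepend_cat -catA -pow_wordSr.
Qed.

Lemma contracts_fixpoint : exists2 p, cone u p & h p = p.
Proof.
have [z ez] := periodic_point e0.
by exists (prepend u z); [exists z|rewrite hue prepend_cat ez].
Qed.

Lemma fixpoint_deep p N : cone u p -> h p = p -> cone (u ++ pow_word e N) p.
Proof.
move=> [k _ <-] hp; exists k => //.
by rewrite -iter_contracts; elim: N => //= N ->.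
Qed.

Lemma fixpoint_unique p p' :
  cone u p -> h p = p -> cone u p' -> h p' = p' -> p = p'.
Proof.
move=> up hp up' hp'; apply: cone_separated => N.
exists (u ++ pow_word e N); last by split; exact: fixpoint_deep.
by rewrite size_cat; apply: leq_trans (leq_addl _ _); exact: leq_size_pow_word.
Qed.

(** Near [p] the map [f] replaces a single prefix, so it sends [u e^M k] to
    [t k] for some [t]; on this cone [f h = h f] reads [t e k = h (t k)]. *)
Lemma commuting_contracts p f L : cone u p -> h p = p ->
  table f L -> commutes f h ->
  exists M t, (forall k, f (prepend (u ++ pow_word e M) k) = prepend t k) /\
              contracts h t e.
Proof.
move=> up hp [cov act] fh.
have [[w w'] wL wp] := cov p; rewrite /= in wp.
have [|v vE] := cone_comparable wp (fixpoint_deep (size w) up hp).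
  by rewrite size_cat; apply: leq_trans (leq_addl _ _); exact: leq_size_pow_word.
have fE k : f (prepend (u ++ pow_word e (size w)) k) = prepend (w' ++ v) k.
  by rewrite vE !prepend_cat (act _ wL).
exists (size w), (w' ++ v); split=> // k.
rewrite -fE -fh -iter_contracts -iterS iterSr hue prepend_cat iter_contracts fE.
by rewrite -prepend_cat.
Qed.

End Contraction.

(** Only the attracting side is recorded, the exceptional point [q] standing for
    the repelling one: in this form the property passes from [h] to the maps
    that commute with it. *)
Definition north_south h u e q :=
  [/\ e <> [::], contracts h u e & forall x, x <> q -> exists N, cone u (iter N h x)].

Section NorthSouth.
Variables (h : cantor n -> cantor n) (u e : seq 'I_n) (p q : cantor n).
Hypotheses (ns : north_south h u e q) (up : cone u p) (hp : h p = p).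

Let e0 : e <> [::]. Proof. by case: ns. Qed.
Let hue : contracts h u e. Proof. by case: ns. Qed.

Lemma enters_deep M x : x <> q -> exists N, cone (u ++ pow_word e M) (iter N h x).
Proof.
case: ns => _ _ H /H [N [k _ kE]]; exists (M + N).
by rewrite iterD -kE (iter_contracts hue); exists k.
Qed.

(** The fixed point [f p] of [h] is attracting, since [f] carries contracted
    cones to contracted cones.  Orbits starting close to it enter the cone of
    [u], so it lies in this cone, where [p] is the only fixed point. *)
Lemma commuting_fixes f L : table f L -> commutes f h -> f p = p.
Proof.
move=> tf fh; have [M [t [ft ct]]] := commuting_contracts e0 hue up hp tf fh.
have tfp : cone t (f p).
  by have [k _ <-] := fixpoint_deep hue M up hp; rewrite ft; exists k.
have hfp : h (f p) = f p by rewrite -fh hp.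
have [k tk] : exists k, prepend t k <> q.
  have [k qk] := two_points q; have [k' kk] := two_points k.
  case: (pselect (prepend t k = q)) => [tkq|]; last by exists k.
  by exists k' => /esym; rewrite -tkq => /prepend_inj /esym.
have [N] := enters_deep 0 tk; rewrite cats0 => uN.
have uNK : cone u (prepend (t ++ pow_word e (size u + N)) k).
  rewrite -(iter_contracts ct) iterD; case: uN => k' _ <-.
  by rewrite (iter_contracts hue); apply: (@cone_cat _ (pow_word e (size u))); exists k'.
apply: (fixpoint_unique e0 hue) => //.
have [||v vE] := cone_comparable uNK (_ : cone (t ++ pow_word e (size u + N)) _).
- by exists k.
- rewrite size_cat; apply: leq_trans (leq_addl _ _).
  by apply: leq_trans (leq_size_pow_word _ e0); exact: leq_addr.
apply: (@cone_cat _ v); rewrite -vE; exact: (fixpoint_deep ct).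
Qed.

(** Some [h^k x] lies in the cone of [s], and then [f^N] brings it arbitrarily
    close to [p].  As [f^N h^k x = h^k (f^N x)], for large [N] this point lies
    in the [h^k]-image of a small cone around [p], hence [f^N x] lies in that
    small cone, which is contained in the cone of [s]. *)
Lemma commuting_north_south f s r : commutes f h -> f p = p -> cone s p ->
  r <> [::] -> contracts f s r -> injective h -> north_south f s r q.
Proof.
move=> fh fp sp r0 fsr hinj; split=> // x /(enters_deep (size s)) [k kE].
have sup : exists v, u ++ pow_word e (size s) = s ++ v.
  apply: cone_comparable sp (fixpoint_deep hue _ up hp) _.
  by rewrite size_cat; apply: leq_trans (leq_addl _ _); exact: leq_size_pow_word.
have {kE} : cone s (iter k h x).
  by case: sup => v vE; apply: (@cone_cat _ v); rewrite -vE.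
move=> [y _ yE].
pose N := size (u ++ pow_word e (k + size s)).
have [|v vE] := cone_comparable (fixpoint_deep hue (k + size s) up hp)
  (fixpoint_deep fsr N sp fp).
  by rewrite [leqRHS]size_cat; apply: leq_trans (leq_addl _ _); exact: leq_size_pow_word.
exists N; suff -> : iter N f x = prepend (u ++ pow_word e (size s)) (prepend v y).
  case: sup => v' ->; rewrite prepend_cat.
  by exists (prepend v' (prepend v y)).
have hkinj : injective (iter k h) by elim: (k) => //= k' IH a b /hinj /IH.
apply: hkinj; rewrite -(iter_commutes _ _ _ fh) -yE (iter_contracts fsr) vE.
rewrite [in RHS]prepend_cat (iter_contracts hue).
by rewrite -!prepend_cat pow_wordD !catA.
Qed.

End NorthSouth.

(** Let [g] send the [h]-contracted cone of [u e^M] to the cone of [t].  Both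
    words are prefixes of the attracting point [p], so one extends the other:
    if they are equal then [g] is the identity on a cone that absorbs all
    orbits of [h] but one; otherwise [g] or its inverse contracts the cone of
    the shorter word. *)
Lemma centralizer_fixpoint (g h : homeo (cantor n)) u e q :
  g \in @in_V n -> g <> 1%g -> north_south h u e q -> commute g h ->
  exists p, forall f : homeo (cantor n), f \in @in_V n -> commute f g -> f p = p.
Proof.
have app (a b : homeo (cantor n)) : commute a b -> commutes a b.
  by move=> ab x; rewrite -[LHS]/((a * b)%g x) ab.
move=> /in_V_table [L tg] g1 ns /[dup] /app gh gh'; have [e0 hue _] := ns.
have [p up hp] := contracts_fixpoint e0 hue; exists p => f /in_V_table [Lf tf] fg.
have gp : g p = p by exact: (commuting_fixes ns up hp tg gh).
have [M [t [gt _]]] := commuting_contracts e0 hue up hp tg gh.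
have dp := fixpoint_deep hue M up hp.
have tp : cone t p by rewrite -gp; case: dp => k _ <-; rewrite gt; exists k.
have hinj : injective h by apply: can_inj (@homeo_funK _ h).
have ginj : injective g by apply: can_inj (@homeo_funK _ g).
have not_id : u ++ pow_word e M <> t.
  move=> tE; apply: g1.
  have gid x : x <> q -> g x = x.
    move=> /(enters_deep ns M) [N [k _ kN]].
    have hNinj : injective (iter N h) by elim: (N) => //= N' IH a b /hinj /IH.
    apply: hNinj; rewrite -[LHS](iter_commutes 1 N x gh) /= -kN.
    by rewrite gt tE.
  apply: homeoP => x; rewrite -[RHS]/x.
  case: (pselect (x = q)) => [->|/gid //].
  by case: (pselect (g q = q)) => // gq; case: (gq); apply: ginj; exact: gid.
have inv_gp : (g^-1)%g p = p by rewrite -{1}gp -[LHS]/(homeo_inv g (g p)) homeo_funK.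
case: (leqP (size (u ++ pow_word e M)) (size t)) => [le|/ltnW le].
  have [r tE] := cone_comparable dp tp le.
  have r0 : r <> [::] by move=> rE; apply: not_id; rewrite tE rE cats0.
  have gr : contracts g (u ++ pow_word e M) r by move=> k; rewrite gt tE.
  have ng := commuting_north_south ns up hp gh gp dp r0 gr hinj.
  by apply: (commuting_fixes ng dp gp tf); exact: app.
have [r tE] := cone_comparable tp dp le.
have r0 : r <> [::] by move=> rE; apply: not_id; rewrite tE rE cats0.
have gr : contracts (g^-1)%g t r.
  by move=> k; rewrite -gt tE -[LHS]/(homeo_inv g (g _)) homeo_funK.
have gVh : commutes (g^-1)%g h by apply/app/commute_sym/commuteV/commute_sym.
have ng := commuting_north_south ns up hp gVh inv_gp tp r0 gr hinj.
by apply: (commuting_fixes ng tp inv_gp tf); apply/app/commuteV.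
Qed.

End Dynamics.

(** * Words in free generators *)

(** The first bit selects one of two free generators; [(b, true)] stands for the
    generator and [(b, false)] for its inverse. *)
Notation letter := (bool * bool)%type.
Definition linv (x : letter) : letter := (x.1, ~~ x.2).

Lemma linvK : involutive linv.
Proof. by case=> a b; rewrite /linv /= negbK. Qed.

Lemma linv_neq x : x != linv x.
Proof. by case: x => a []; rewrite /linv xpair_eqE /= andbF. Qed.

Definition reduced : rel letter := fun x y => y != linv x.

Section Evaluation.
Local Open Scope group_scope.
Variables (G : groupType) (gen : letter -> G).
Hypothesis genV : forall x, gen (linv x) = (gen x)^-1.

Definition eval_word (w : seq letter) : G := \prod_(x <- w) gen x.

Lemma eval_nil : eval_word [::] = 1.
Proof. exact: big_nil. Qed.

Lemma eval_cat w1 w2 : eval_word (w1 ++ w2) = eval_word w1 * eval_word w2.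
Proof. exact: big_cat. Qed.

Lemma eval_cons x w : eval_word (x :: w) = gen x * eval_word w.
Proof. exact: big_cons. Qed.

Lemma eval_rcons w x : eval_word (rcons w x) = eval_word w * gen x.
Proof. by rewrite -cats1 eval_cat /eval_word big_seq1. Qed.

Lemma eval_inv w : (eval_word w)^-1 = eval_word (rev (map linv w)).
Proof.
elim: w => [|x w IH]; first by rewrite /rev /= eval_nil invg1.
by rewrite /= rev_cons eval_rcons -IH eval_cons invgM genV.
Qed.

Lemma not_path_split (T : Type) (r : rel T) x s : ~~ path r x s ->
  exists s1 y z s2, x :: s = s1 ++ y :: z :: s2 /\ ~~ r y z.
Proof.
elim: s x => //= y s IH x; rewrite negb_and => /orP [nxy|/IH].
  by exists [::], x, y, s.
by move=> [s1 [a [b [s2 [-> nab]]]]]; exists (x :: s1), a, b, s2.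
Qed.

(** A word that is not cyclically reduced has two cyclically adjacent inverse
    letters; deleting them shortens the word and changes its value only by a
    conjugation. *)
Lemma cyclic_reduction w : eval_word w = 1 \/
  exists v c, [/\ c <> [::], cycle reduced c &
    eval_word w = eval_word v * eval_word c * (eval_word v)^-1].
Proof.
have [m] := ubnP (size w); elim: m w => // m IH [|x w]; first by left; exact: eval_nil.
move=> /= wm; case: (boolP (cycle reduced (x :: w))) => [cyc|ncyc].
  right; exists [::], (x :: w); split=> //.
  by rewrite eval_nil invg1 mulg1 mul1g.
have [s1 [y [z [s2 []]]]] := not_path_split ncyc.
(* Either the offending pair is the last and the first letter of the word, or it
   consists of two consecutive letters inside the word. *)
rewrite negbK; case/lastP: s2 => [|s2 x'].
  rewrite -cats1 -[[:: y; z]]/([:: y] ++ [:: z]) catA !cats1 -rcons_cons.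
  move=> /rcons_inj [wE xz] /eqP zE; subst z.
  case: s1 wE => [[yx _]|x1 s1 [xE wE]].
    by have := linv_neq y; rewrite -zE yx eqxx.
  have [|e1|[v [c [c0 cc e]]]] := IH s1.
  - by move: wm; rewrite wE size_rcons ltnS => /ltnW.
  - left; subst x1; rewrite wE eval_cons eval_rcons e1 mul1g.
    by rewrite zE genV mulVg.
  - right; exists (x :: v), c; split=> //; rewrite wE eval_cons eval_rcons e.
    by rewrite zE eval_cons invgM genV invgK !mulgA.
rewrite -[z :: _]rcons_cons -[y :: _]rcons_cons -rcons_cat -rcons_cons.
move=> /rcons_inj [wE _] /eqP zE; subst z.
have xwE : eval_word (x :: w) = eval_word (s1 ++ s2).
  by rewrite wE !eval_cat !eval_cons genV mulVKg.
rewrite xwE; apply: IH; apply: leq_trans (_ : (size w).+1 <= m); last exact: wm.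
rewrite -[(size w).+1]/(size (x :: w)) wE !size_cat /= !addnS.
by rewrite ltnS leqnSn.
Qed.

End Evaluation.

(** * Equivariant maps out of a conjugation action *)

Section EquivariantSelection.
Local Open Scope group_scope.

(** Choosing a base point in every orbit and a fixed point for its stabilizer
    extends uniquely to an equivariant map, here for a subgroup [H] acting on a
    set [S] of group elements by conjugation. *)
Lemma equivariant_selection (G : groupType) (Y : Type) (y0 : Y)
    (act : G -> Y -> Y) (H S : set G) :
  (forall y, act 1 y = y) -> (forall a b y, act (a * b) y = act a (act b y)) ->
  H 1 -> (forall a b, H a -> H b -> H (a * b)) -> (forall a, H a -> H a^-1) ->
  (forall a g, H a -> S g -> S (g ^ a)) ->
  (forall g, S g -> exists y, forall a, H a -> commute a g -> act a y = y) ->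
  exists F : G -> Y, forall a g, H a -> S g -> F (g ^ a) = act a^-1 (F g).
Proof.
move=> act1 actM H1 HM HV SJ fix_pt.
pose orb g := [set g ^ a | a in H]; pose base g := xget 1 (orb g).
have base_orb g : orb g (base g) by apply: xgetPex; exists (g ^ 1), 1.
have baseJ g a : H a -> base (g ^ a) = base g.
  move=> Ha; congr xget; apply/seteqP; split=> _ [b Hb <-].
    by exists (a * b); [exact: HM|rewrite conjgM].
  by exists (a^-1 * b); [exact/HM/Hb/HV|rewrite conjgM conjgK].
have [t tP] : {t : G -> G & forall g, H (t g) /\ base g ^ t g = g}.
  apply: (@choice _ _ (fun g a => H a /\ base g ^ a = g)) => g.
  have [b Hb bE] := base_orb g.
  by exists b^-1; split; [exact: HV|rewrite -bE conjgK].
have [y yP] : {y : G -> Y & forall g, S g ->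
    forall a, H a -> commute a g -> act a (y g) = y g}.
  apply: (@choice _ _ (fun g z => S g ->
    forall a, H a -> commute a g -> act a z = z)) => g.
  case: (pselect (S g)) => [/fix_pt [y yP]|nS]; first by exists y.
  by exists y0.
exists (fun g => act (t g)^-1 (y (base g))) => a g Ha Sg.
rewrite baseJ // -actM -invgM; set r := base g.
have [Htg tgE] := tP g; have [Hta] := tP (g ^ a); rewrite baseJ // => taE.
have Sr : S r by have [b Hb rE] := base_orb g; rewrite /r -rE; exact: SJ.
(* Two ways of reaching [g ^ a] from the base point differ by an element of its
   stabilizer, which fixes the chosen point. *)
set c := t (g ^ a) * (t g * a)^-1.
have Hc : H c := HM _ _ Hta (HV _ (HM _ _ Htg Ha)).
have rc : commute c r.
  apply/commute_sym/commgP; rewrite -conjg_fix.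
  by rewrite /c invgM !conjgM taE conjgK -{1}tgE conjgK.
by rewrite -{1}(yP r Sr c Hc rc) -actM /c mulKg.
Qed.

End EquivariantSelection.

(** * Ping-pong on cones *)

Section PingPong.
Local Open Scope group_scope.
Variable n : nat.
Hypothesis n_gt1 : (1 < n)%N.
Implicit Types (u v e : seq 'I_n) (xi : cantor n) (x y z : letter) (w : seq letter).

Variables (gen : letter -> homeo (cantor n)) (wd : letter -> seq 'I_n).
Hypothesis genV : forall x, gen (linv x) = (gen x)^-1.
Hypothesis gen_replaces : forall x z : letter, z != linv x ->
  exists2 e, e <> [::] & replaces (gen x) (wd z) (wd x ++ e).
Hypothesis gen_absorbs : forall x xi,
  ~ cone (wd (linv x)) xi -> cone (wd x) (gen x xi).
Hypothesis wd_disjoint : forall x y xi, cone (wd x) xi -> cone (wd y) xi -> x = y.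

Notation ev := (eval_word gen).

(** The letters act from the right, and by reducedness no letter ever meets the
    cone of its inverse; each of them lengthens the suffix [e], which is what
    makes cyclically reduced words contract. *)
Lemma reduced_replaces x w z : path reduced x w -> z != linv (last x w) ->
  exists2 e, e <> [::] & replaces (ev (x :: w)) (wd z) (wd x ++ e).
Proof.
elim: w x => [|y w IH] x.
  by move=> _ /gen_replaces; rewrite eval_cons eval_nil mulg1.
move=> /= /andP [xy yw] /(IH _ yw) [e e0 evE].
have [e' e'0 gE] := gen_replaces xy.
exists (e' ++ e) => [|k]; first by case: e' e'0 {gE}.
rewrite eval_cons -[LHS]/(gen x (ev (y :: w) _)) evE prepend_cat gE.
by rewrite catA [RHS]prepend_cat.
Qed.

Lemma reduced_inv_replaces x w z : path reduced x w -> z != x ->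
  exists2 e, e <> [::] & replaces (ev (x :: w))^-1 (wd z) (wd (linv (last x w)) ++ e).
Proof.
move=> xw zx.
have [w' rE] : exists w', rev (map linv (x :: w)) = linv (last x w) :: w'.
  by exists (rev (map linv (belast x w))); rewrite lastI map_rcons rev_rcons.
have : sorted reduced (rev (map linv (x :: w))).
  rewrite rev_sorted sorted_map /=; apply: sub_path xw => a b.
  by rewrite /reduced /= linvK eq_sym.
rewrite eval_inv // rE /= => /reduced_replaces; apply.
suff -> : last (linv (last x w)) w' = linv x by rewrite linvK.
by rewrite -[LHS]/(last x (linv (last x w) :: w')) -rE /= rev_cons last_rcons.
Qed.

Lemma reduced_absorbs x w xi : path reduced x w ->
  ~ cone (wd (linv (last x w))) xi -> cone (wd x) (ev (x :: w) xi).
Proof.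
elim: w x => [|y w IH] x.
  by move=> _ /gen_absorbs; rewrite eval_cons eval_nil mulg1.
move=> /= /andP [xy yw] /(IH _ yw) [k _ kE].
have [e _ gE] := gen_replaces xy.
rewrite eval_cons -[ev_ in cone _ ev_]/(gen x (ev (y :: w) xi)) -kE gE prepend_cat.
by exists (prepend e k).
Qed.

(** A cyclically reduced word starting with [x] and ending with [y] contracts
    the cone of [x], its inverse contracts the cone of [y^-1], and it maps the
    complement of the latter into the former.  An orbit that never enters the
    cone of [x] thus stays in the cone of [y^-1], so it starts at the fixed
    point of the inverse word there. *)
Lemma cyclically_reduced_north_south c : c <> [::] -> cycle reduced c ->
  exists u e q, north_south (ev c) u e q.
Proof.
case: c => // x w _ /=; rewrite rcons_path => /andP [xw lx].
set y := linv (last x w) in lx.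
have [e e0 evE] := reduced_replaces xw lx.
have [|e' e'0 evVE] := reduced_inv_replaces (z := y) xw; first by rewrite eq_sym.
have [q yq evq] := contracts_fixpoint e'0 evVE.
exists (wd x), e, q; split=> // xi xiq; apply: contrapT => out.
have stay N : cone (wd y) (iter N (ev (x :: w)) xi).
  apply: contrapT => /(reduced_absorbs xw) ux; apply: out.
  by exists N.+1.
apply: xiq; apply: cone_separated => N; exists (wd y ++ pow_word e' N).
  by rewrite size_cat; apply: leq_trans (leq_addl _ _); exact: leq_size_pow_word.
split; last exact: (fixpoint_deep evVE).
have [k _ kE] := stay N; exists k => //.
rewrite -(iter_contracts evVE) kE; elim: N {k kE} => // N IH.
rewrite iterSr /=.
by rewrite -[X in iter N _ X]/(homeo_inv (ev (x :: w)) (ev (x :: w) _)) homeo_funK.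
Qed.

Hypothesis gen_in_V : forall x, gen x \in @in_V n.

Lemma eval_in_V w : ev w \in @in_V n.
Proof.
elim: w => [|x w IH]; first by rewrite eval_nil; exact: in_V1.
by rewrite eval_cons; apply: in_VM.
Qed.

(** A nontrivial word commuting with [g] is conjugate to a cyclically reduced
    one, whose dynamics [g] inherits up to this conjugation; when no nontrivial
    word commutes with [g], any point will do. *)
Lemma free_centralizer_fixpoint (g : homeo (cantor n)) : g \in @in_V n -> g <> 1 ->
  exists p, forall w, commute (ev w) g -> ev w p = p.
Proof.
move=> gV g1.
case: (pselect (exists2 w, commute (ev w) g & ev w <> 1)); last first.
  move=> triv; exists (fun=> Ordinal (ltnW n_gt1)) => w wg.
  suff -> : ev w = 1 by [].
  by apply: contrapT => w1; apply: triv; exists w.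
move=> [w wg w1]; case: (cyclic_reduction genV w) => [//|[v [c [c0 cc wE]]]].
have [u [e [q ns]]] := cyclically_reduced_north_south c0 cc.
have evVV : (ev v)^-1 \in @in_V n by apply/in_VV/eval_in_V.
have cJ f : commute f g -> commute (f ^ ev v) (g ^ ev v).
  by rewrite /commute -!conjMg => ->.
have inVJ f : f \in @in_V n -> f ^ ev v \in @in_V n.
  by move=> fV; do 2!apply: in_VM => //; exact: eval_in_V.
have [||||p pP] := @centralizer_fixpoint n n_gt1 (g ^ ev v) (ev c) u e q.
- exact: inVJ.
- by move=> /eqP; rewrite conjg_eq1 => /eqP.
- exact: ns.
- suff -> : ev c = ev w ^ ev v by apply/commute_sym/cJ.
  by rewrite wE conjgE !mulgA mulVg mul1g mulgVK.
exists (ev v p) => w' /cJ /pP -/(_ (inVJ _ (eval_in_V w'))) fp.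
by rewrite -{2}fp -[RHS]/((ev v * (ev w' ^ ev v))%g p) -conjgC.
Qed.

(** The pushforward of an invariant mean along an equivariant map to the Cantor
    set gives the four disjoint cones total mass at least 2: each generator [x]
    moves the complement of the cone of [x^-1] into the cone of [x]. *)
Lemma ping_pong_not_inner_amenable (R : realType) (G : groupType)
    (phi : G -> homeo (cantor n)) (lift : letter -> G) :
  {morph phi : a b / a * b >-> a * b} -> injective phi ->
  (forall a, phi a \in @in_V n) -> (forall x, phi (lift x) = gen x) ->
  ~ inner_amenable R G.
Proof.
move=> phiM phi_inj phi_in_V liftE [mu [[muT mu_ge0 muU] mu_inv]].
have phi1 : phi 1 = 1 by apply: (mulgI (phi 1)); rewrite -phiM !mulg1.
have phiV a : phi a^-1 = (phi a)^-1.
  by apply: (mulgI (phi a)); rewrite -phiM !mulgV.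
have phiJ a b : phi (a ^ b) = phi a ^ phi b by rewrite !conjgE !phiM phiV.
have [F FJ] : exists F : homeo (cantor n) -> cantor n, forall a g,
    (range ev) a -> g \in @in_V n /\ g <> 1 -> F (g ^ a) = a^-1 (F g).
  apply: (@equivariant_selection _ _ (fun=> Ordinal (ltnW n_gt1))
    (fun a : homeo (cantor n) => a : cantor n -> cantor n)) => //.
  - by exists [::]; rewrite ?eval_nil.
  - by move=> _ _ [v _ <-] [w _ <-]; exists (v ++ w); rewrite ?eval_cat.
  - by move=> _ [v _ <-]; exists (rev (map linv v)); rewrite ?eval_inv.
  - move=> _ g [v _ <-] [gV g1]; split.
      by apply: in_VM (in_VM gV _); [apply: in_VV|]; exact: eval_in_V.
    by move=> /eqP; rewrite conjg_eq1 => /eqP.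
  - move=> g [gV g1]; have [p pP] := free_centralizer_fixpoint gV g1.
    by exists p => _ [w _ <-]; exact: pP.
pose E x := [set g | g <> 1 /\ cone (wd x) (F (phi g))].
have EX x : E x `<=` [set~ 1] by move=> g [].
have mu_mono A B : A `<=` B -> B `<=` [set~ 1] -> (mu A <= mu B)%R.
  move=> AB BX; rewrite -(setDUK AB) muU ?setDIK //; last 2 first.
  - exact: subset_trans AB BX.
  - by move=> g [/BX].
  by rewrite lerDl mu_ge0 // => g [/BX].
have half x : (1 <= mu (E x) + mu (E (linv x)))%R.
  rewrite -muT -(setDUK (EX (linv x))) muU ?setDIK //.
  rewrite addrC lerD2r -(mu_inv (lift x)^-1); last by move=> g [].
  apply: mu_mono => // _ [g [g1 out] <-]; split.
    by move=> /eqP; rewrite conjg_eq1 => /eqP.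
  rewrite phiJ phiV liftE FJ //; first last.
  - by split=> // /eqP; rewrite -phi1 (inj_eq phi_inj) => /eqP.
  - by exists [:: linv x]; rewrite // eval_cons eval_nil mulg1 genV.
  by rewrite invgK; apply: gen_absorbs => Fg; apply: out.
have disj x y : x <> y -> E x `&` E y = set0.
  move=> xy; apply/seteqP; split=> // g [[_ Fx] [_ Fy]].
  exact/xy/(wd_disjoint Fx Fy).
pose a1 := (true, true); pose b1 := (false, true).
have Ea := half a1; have Eb := half b1.
pose U x := E x `|` E (linv x).
have UX x : U x `<=` [set~ 1] by move=> g [] [].
have muE x : mu (U x) = (mu (E x) + mu (E (linv x)))%R.
  by rewrite muU // disj //; apply/eqP/linv_neq.
have : (mu (U a1 `|` U b1) <= 1)%R.
  by rewrite -muT; apply: mu_mono => // g [] /UX.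
rewrite muU //; last by rewrite /U setIUl !setIUr !disj ?setU0.
by rewrite !muE; lra.
Qed.

End PingPong.

(** * Homeomorphisms from partitions into cones *)

Section PrefixReplacement.
Variable n : nat.
Implicit Types (u v : seq 'I_n) (x y : cantor n).

Lemma near_agree x M : \forall y \near x, forall i, i < M -> y i = x i.
Proof.
elim: M => [|M IH]; first by apply: filterE.
have xM : \forall y \near x, y M = x M.
  have : nbhs (x M : discrete_topology 'I_n) [set x M] by [].
  exact: (@proj_continuous _ (fun _ : nat => discrete_topology 'I_n) M x).
near=> y => i; rewrite ltnS leq_eqVlt => /predU1P [->|]; first by near: y.
by move: i; near: y.
Unshelve. all: by end_near. Qed.

Lemma finite_dependence_continuous (f : cantor n -> cantor n) :
  (forall x i, exists M, forall y, (forall j, j < M -> y j = x j) -> f y i = f x i) ->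
  continuous f.
Proof.
move=> dep x.
have Ff : Filter (f @ x).
  exact: (@fmap_filter _ _ f (nbhs x) (@nbhs_filter (cantor n) x)).
apply/cvg_sup => i U [V] [[W] oW <-] Wfx WU.
have [M HM] := dep x i; apply: filterS (near_agree x M) => y /HM e.
by apply: WU; rewrite /= /mathcomp_extra.proj e.
Qed.

Lemma prefix_replacement_continuous (f : cantor n -> cantor n) :
  (forall x, exists2 u, cone u x & exists v, replaces f u v) -> continuous f.
Proof.
move=> fP; apply: finite_dependence_continuous => x i.
have [u [k _ <-] [v fuv]] := fP x; exists (size u + i.+1) => y yx.
have [k' yE] : exists k', y = prepend u k'.
  exists (fun j => y (size u + j)); apply/funext => j.
  case: (ltnP j (size u)) => ju; last by rewrite /prepend nth_default // subnKC.
  by rewrite yx 1?ltn_addr // !(prepend_nth _ (k 0) ju).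
have kk' j : j < i.+1 -> k' j = k j.
  move=> ji; have := yx (size u + j); rewrite yE ltn_add2l => /(_ ji).
  by rewrite /prepend !nth_default ?leq_addr // addKn.
rewrite yE !fuv; case: (ltnP i (size v)) => iv.
  by rewrite !(prepend_nth _ (k 0) iv).
by rewrite /prepend !nth_default // kk' // ltnS leq_subr.
Qed.

Lemma partition_map k (w v : 'I_k -> seq 'I_n) (s : 'I_k -> 'I_k) :
  cone_partition w -> exists f : cantor n -> cantor n,
    forall i, replaces f (w i) (v (s i)).
Proof.
move=> [cw dw].
have [f fP] : {f : cantor n -> cantor n & forall x, exists i y,
    x = prepend (w i) y /\ f x = prepend (v (s i)) y}.
  apply: (@choice _ _ (fun x z => exists i y,
    x = prepend (w i) y /\ z = prepend (v (s i)) y)) => x.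
  have [i _ [y _ <-]] : (\bigcup_i cone (w i)) x by rewrite cw.
  by exists (prepend (v (s i)) y), i, y.
exists f => i x; have [j [y [e ->]]] := fP (prepend (w i) x).
have ij : i = j.
  by apply: dw => //; exists (prepend (w i) x); split; [exists x|exists y].
by rewrite ij in e *; rewrite (prepend_inj e).
Qed.

Lemma prefix_replacement_exists k (w v : 'I_k -> seq 'I_n) (s : 'I_k -> 'I_k) :
  cone_partition w -> cone_partition v -> bijective s ->
  exists f : homeo (cantor n), prefix_replacement w v s f.
Proof.
move=> pw pv [s' sK s'K].
have [f fE] := partition_map v s pw; have [g gE] := partition_map w s' pv.
have cover (t : 'I_k -> seq 'I_n) x : cone_partition t -> exists i y, x = prepend (t i) y.
  move=> [ct _]; have [i _ [y _ <-]] : (\bigcup_i cone (t i)) x by rewrite ct.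
  by exists i, y.
have fK : cancel f g.
  by move=> x; have [i [y ->]] := cover w x pw; rewrite fE gE sK.
have gK : cancel g f.
  by move=> x; have [i [y ->]] := cover v x pv; rewrite gE fE s'K.
have cf : continuous f.
  apply: prefix_replacement_continuous => x; have [i [y ->]] := cover w x pw.
  by exists (w i); [exists y|exists (v (s i)); exact: fE].
have cg : continuous g.
  apply: prefix_replacement_continuous => x; have [i [y ->]] := cover v x pv.
  by exists (v i); [exists y|exists (w (s' i)); exact: gE].
by exists (Homeo fK gK cf cg); split=> //; exists s'.
Qed.

End PrefixReplacement.

(** * Elements of T with prescribed north-south dynamics *)

Section Generators.
Variable n : nat.
Hypothesis n_gt1 : 1 < n.
Let n_gt0 : 0 < n := ltnW n_gt1.
Implicit Types (x : cantor n).

(** Reducing modulo [n] makes digits total; [word2 j] is the [j]-th two-letter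
    word in lexicographic order when [j < n * n]. *)
Definition digit (k : nat) : 'I_n := Ordinal (ltn_pmod k n_gt0).

Definition word2 (j : nat) : seq 'I_n := [:: digit (j %/ n); digit (j %% n)].

Local Notation N := (n * n).

Lemma digit_div j : j < N -> digit (j %/ n) = (j %/ n) :> nat.
Proof. by move=> jN; rewrite /= modn_small // ltn_divLR. Qed.

Lemma digit_mod j : digit (j %% n) = (j %% n) :> nat.
Proof. by rewrite /= modn_mod. Qed.

Lemma word2_lt i j (s t : seq 'I_n) : i < j -> j < N ->
  ((word2 i ++ s : seqlexi 'I_n) < word2 j ++ t)%O.
Proof.
move=> ij jN; have iN := ltn_trans ij jN.
rewrite /= !ltxi_cons !leEord !digit_div // !digit_mod.
have dij : i %/ n <= j %/ n by rewrite leq_div2r // ltnW.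
rewrite dij /=; apply/implyP => dji.
have de : i %/ n = j %/ n by apply/eqP; rewrite eqn_leq dij.
have mij : i %% n < j %% n.
  by move: ij; rewrite {1}(divn_eq i n) {1}(divn_eq j n) de ltn_add2l.
by rewrite (ltnW mij) leqNgt mij.
Qed.

Lemma word2_inj i j : i < N -> j < N -> word2 i = word2 j -> i = j.
Proof.
move=> iN jN [d]; rewrite !modn_mod => m.
rewrite !modn_small ?ltn_divLR // in d.
by rewrite (divn_eq i n) (divn_eq j n) d m.
Qed.

Lemma word2_disjoint i j x : i < N -> j < N ->
  cone (word2 i) x -> cone (word2 j) x -> i = j.
Proof. by move=> iN jN xi xj; apply: word2_inj => //; exact: cone_disjoint xj. Qed.

Lemma word2_cover x : exists2 j, j < N & cone (word2 j) x.
Proof.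
pose a := x 0 : 'I_n; pose b := x 1 : 'I_n.
have jN : a * n + b < N.
  apply: leq_trans (_ : a.+1 * n <= _); first by rewrite mulSn addnC ltn_add2r.
  by rewrite leq_mul2r ltn_ord orbT.
exists (a * n + b) => //; exists (fun i => x i.+2) => //.
apply/funext => -[|[|i]]; rewrite /prepend //=.
- by apply: val_inj; rewrite /= divnMDl // divn_small // addn0 modn_small.
- by apply: val_inj; rewrite /= modnMDl modn_mod modn_small.
- by rewrite nth_default // subn2.
Qed.

(** The partition into the cones of the two-letter words, with the [j0]-th one
    subdivided in the same way, listed in lexicographic order. *)
Definition code j0 i : seq 'I_n :=
  if i < j0 then word2 i
  else if i < j0 + N then word2 j0 ++ word2 (i - j0)
  else word2 (i - N.-1).

Local Notation K := (N + N).-1.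

Lemma code_single j0 z : z < N -> z != j0 ->
  exists2 i, i < K & code j0 i = word2 z /\ i = if z < j0 then z else z + N.-1.
Proof.
move=> zN zj; exists (if z < j0 then z else z + N.-1); first by case: ifP; lia.
split=> //; case: ltnP => jz; rewrite /code; first by rewrite jz.
have -> : (z + N.-1 < j0) = false by lia.
have -> : (z + N.-1 < j0 + N) = false by lia.
by rewrite addnK.
Qed.

Lemma code_block j0 d : d < N -> code j0 (j0 + d) = word2 j0 ++ word2 d.
Proof. by move=> dN; rewrite /code ltnNge leq_addr /= ltn_add2l dN addKn. Qed.

Lemma code_lt j0 i j : j0 < N -> i < j -> j < K ->
  ((code j0 i : seqlexi 'I_n) < code j0 j)%O.
Proof.
move=> jN ij jK.
have pre a b : a < b -> b < N ->
    ((word2 j0 ++ word2 a : seqlexi 'I_n) < word2 j0 ++ word2 b)%O.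
  move=> ab bN; have := word2_lt [::] [::] ab bN; rewrite !cats0 => h.
  by rewrite /= !ltxi_cons !lexx /=.
have W0 a b t : a < b -> b < N -> ((word2 a : seqlexi 'I_n) < word2 b ++ t)%O.
  by move=> ab bN; have := word2_lt [::] t ab bN; rewrite cats0.
have W1 a b s : a < b -> b < N -> ((word2 a ++ s : seqlexi 'I_n) < word2 b)%O.
  by move=> ab bN; have := word2_lt s [::] ab bN; rewrite cats0.
have W2 a b : a < b -> b < N -> ((word2 a : seqlexi 'I_n) < word2 b)%O.
  by move=> ab bN; have := W1 _ _ [::] ab bN; rewrite cats0.
rewrite /code; do !case: ltnP => ?; try (exfalso; lia).
- by apply: W2; lia.
- by apply: W0; lia.
- by apply: W2; lia.
- by apply: pre; lia.
- by apply: W1; lia.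
- by apply: W2; lia.
Qed.

Lemma code_partition j0 : j0 < N -> cone_partition (fun i : 'I_K => code j0 i).
Proof.
move=> jN; split.
  apply/seteqP; split=> // x _; have [j jN' [y _ <-]] := word2_cover x.
  case: (eqVneq j j0) => [->|jj0].
    have [d dN [z _ <-]] := word2_cover y.
    have dK : j0 + d < K by lia.
    exists (Ordinal dK) => //=; rewrite code_block //.
    by exists z => //; rewrite prepend_cat.
  have [i iK [iE _]] := code_single jN' jj0.
  by exists (Ordinal iK) => //=; rewrite iE; exists y.
move=> i j _ _ [x [xi xj]]; apply: val_inj; move: xi xj => /=.
have := ltn_ord i; have := ltn_ord j; move: (val i) (val j) => {}i {}j jK iK.
pose hd i := if i < j0 then i else if i < j0 + N then j0 else i - N.-1.
have hdP a : cone (code j0 a) x -> cone (word2 (hd a)) x.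
  by rewrite /code /hd; case: ltnP => // _; case: ltnP => // _; exact: cone_cat.
have hd_lt a : a < K -> hd a < N.
  by rewrite /hd => aK; case: ifP => ?; [|case: ifP => ?]; lia.
move=> xi xj.
have := word2_disjoint (hd_lt _ iK) (hd_lt _ jK) (hdP _ xi) (hdP _ xj).
move: xi xj; rewrite /hd /code; do !case: ltnP => ?; try (move=> *; lia).
move=> [y _ yE] [z _ zE] _.
move: yE; rewrite -zE !prepend_cat => /prepend_inj e.
have di : cone (word2 (i - j0)) (prepend (word2 (i - j0)) y) by exists y.
have dj : cone (word2 (j - j0)) (prepend (word2 (i - j0)) y) by rewrite e; exists z.
have : i - j0 = j - j0 by apply: word2_disjoint di dj; lia.
lia.
Qed.

(** The partition subdivided at [j0] and the one subdivided at [i0] have the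
    same size, so a cyclic shift of the list of cones defines an element of T.
    The shift is chosen so that the [N - 1] undivided source cones land inside
    the [i0]-th cone; the undivided target cones then come from inside the
    [j0]-th cone. *)
Lemma generator_exists i0 j0 : i0 < N -> j0 < N ->
  exists2 f : homeo (cantor n), f \in @in_T n &
    (forall z, z < N -> z != j0 -> exists2 e, e <> [::] &
       replaces f (word2 z) (word2 i0 ++ e)) /\
    (forall z, z < N -> z != i0 -> exists2 e, e <> [::] &
       replaces (f^-1)%g (word2 z) (word2 j0 ++ e)).
Proof.
move=> i0N j0N; have K_gt0 : 0 < K by lia.
(* In cyclic order the cone after the block of [j0] has position [j0 + N]; the
   shift sends it to position [i0], the first one in the block of [i0]. *)
pose c := i0 + N.-1 - j0.
pose s (i : 'I_K) : 'I_K := Ordinal (ltn_pmod (i + c) K_gt0).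
have s_inj : injective s.
  move=> i j /(congr1 val) /= /eqP; rewrite eqn_modDr !modn_small // => /eqP.
  exact: val_inj.
have [f ff] := prefix_replacement_exists (code_partition j0N) (code_partition i0N)
  (injF_bij s_inj).
have fE i : i < K -> replaces f (code j0 i) (code i0 ((i + c) %% K)).
  by move=> iK; case: ff => _ _ _ /(_ (Ordinal iK)).
exists f.
  apply/asboolP; exists K, (fun i => code j0 i), (fun i => code i0 i), s.
  split=> // [i j ij|i j ij|i]; [exact: code_lt|exact: code_lt|].
  by apply: val_inj; rewrite /= -[((i + c) %% K).+1]addn1 !modnDml addn1 addSn.
have target d : d < N -> exists2 e, e <> [::] & code i0 (i0 + d) = word2 i0 ++ e.
  by move=> dN; exists (word2 d); rewrite ?code_block.
split=> z zN.
  move=> /[dup] zj /(code_single zN) [i iK [iE ipos]].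
  (* [z] is the [d]-th word after [j0] in cyclic order, counting from 0. *)
  pose d := if z < j0 then z + N.-1 - j0 else z - j0.+1.
  have dN : d < N.-1 by rewrite /d; case: ifP => ?; lia.
  have pos : (i + c) %% K = i0 + d.
    rewrite ipos /d /c; case: ltnP => zj0.
      by rewrite modn_small; lia.
    have -> : z + N.-1 + (i0 + N.-1 - j0) = i0 + (z - j0.+1) + K by lia.
    by rewrite modnDr modn_small //; lia.
  have [|e e0 eE] := target d; first lia.
  by exists e => // k; rewrite -iE fE // pos eE.
move=> /[dup] zi /(code_single zN) [i iK [iE ipos]].
(* The position of [z] is [d] steps after [i0 + N - 1], the last one in the block
   of [i0] and the image of the first one in the block of [j0]. *)
pose d := if z < i0 then z + N - i0 else z - i0.
have dN : d < N by rewrite /d; case: ifP => ?; lia.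
have dK : j0 + d < K by rewrite /d; case: ifP => ?; lia.
have pos : (j0 + d + c) %% K = i.
  rewrite ipos /d /c; case: ltnP => zi0.
    have -> : j0 + (z + N - i0) + (i0 + N.-1 - j0) = z + K by lia.
    by rewrite modnDr modn_small //; lia.
  by rewrite modn_small; lia.
exists (word2 d) => // k; rewrite -iE -pos -(fE _ dK) code_block //.
exact: (homeo_funK f).
Qed.

End Generators.

(** * The free subgroup and the theorem *)

Section FreeSubgroup.
Local Open Scope group_scope.
Variable n : nat.
Hypothesis n_gt1 : (1 < n)%N.

Definition letter_index (x : letter) : nat := (x.1.*2 + x.2)%N.

Definition letter_word (x : letter) : seq 'I_n := word2 n_gt1 (letter_index x).

Lemma letter_index_lt x : (letter_index x < n * n)%N.
Proof.
apply: leq_trans (leq_mul n_gt1 n_gt1).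
by case: x => [[] []].
Qed.

Lemma letter_index_inj : injective letter_index.
Proof. by move=> [[] []] [[] []]. Qed.

Lemma free_generators_exist : exists2 gen : letter -> homeo (cantor n),
  forall x, gen x \in @in_T n /\ gen (linv x) = (gen x)^-1 &
  forall x z, (z < n * n)%N -> z != letter_index (linv x) ->
    exists2 e, e <> [::] &
      replaces (gen x) (word2 n_gt1 z) (letter_word x ++ e).
Proof.
have ex b : exists f : homeo (cantor n), f \in @in_T n /\
    forall z, (z < n * n)%N ->
      (z != letter_index (b, false) -> exists2 e, e <> [::] &
        replaces f (word2 n_gt1 z) (letter_word (b, true) ++ e)) /\
      (z != letter_index (b, true) -> exists2 e, e <> [::] &
        replaces f^-1 (word2 n_gt1 z) (letter_word (b, false) ++ e)).
  have [f fT [f1 f2]] := generator_exists n_gt1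
    (letter_index_lt (b, true)) (letter_index_lt (b, false)).
  by exists f; split=> // z zN; split; [exact: f1|exact: f2].
have [f fP] := choice ex.
exists (fun x => if x.2 then f x.1 else (f x.1)^-1).
  move=> [b []] /=; have [fT _] := fP b; split=> //; last by rewrite invgK.
  exact: in_TV.
by move=> [b []] z zN /=; have [_ /(_ z zN) []] := fP b.
Qed.

(** The embedding [phi] places [G] between T_n and V_n: the free generators come
    from T_n, and the centralizer argument needs elements of V_n. *)
Lemma between_T_and_V_not_inner_amenable (R : realType) (G : groupType)
    (phi : G -> homeo (cantor n)) :
  {morph phi : a b / a * b >-> a * b} -> injective phi ->
  (forall a, phi a \in @in_V n) ->
  (forall f, f \in @in_T n -> exists a, phi a = f) ->
  ~ inner_amenable R G.
Proof.
move=> phiM phi_inj phi_in_V phi_T.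
have [gen genP gen_rep] := free_generators_exist.
have [lift liftE] := choice (fun x => phi_T _ (proj1 (genP x))).
apply: (ping_pong_not_inner_amenable n_gt1 (gen := gen) (wd := letter_word)
  _ _ _ _ _ phiM phi_inj phi_in_V liftE).
- by move=> x; have [] := genP x.
- move=> x z zx; apply: gen_rep; first exact: letter_index_lt.
  by apply: contra_neq zx; exact: letter_index_inj.
- move=> x xi out; have [z zN [k _ kE]] := word2_cover n_gt1 xi.
  have [|e _ gE] := gen_rep x z zN.
    by apply/eqP => zx; apply: out; rewrite /letter_word -zx -kE; exists k.
  by rewrite -kE gE prepend_cat; exists (prepend e k).
- move=> x y xi xx xy; apply: letter_index_inj.
  by apply: word2_disjoint xx xy; exact: letter_index_lt.
- by move=> x; rewrite -liftE.
Qed.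

End FreeSubgroup.

Theorem theorem3p1 (R : realType) (n : nat) (hn : 2 <= n) :
  ~ inner_amenable R (HT_T n) /\ ~ inner_amenable R (HT_V n).
Proof.
have in_TV_sub f : f \in @in_T n -> f \in @in_V n.
  by move=> /in_TP => /(_ (ltnW hn)) [].
split.
- apply: (@between_T_and_V_not_inner_amenable n hn R (HT_T n) val) => //.
  + exact: val_inj.
  + by move=> a; apply/in_TV_sub/valP.
  + by move=> f fT; exists (Sub f fT); rewrite SubK.
- apply: (@between_T_and_V_not_inner_amenable n hn R (HT_V n) val) => //.
  + exact: val_inj.
  + by move=> a; exact: valP.
  + by move=> f /in_TV_sub fV; exists (Sub f fV); rewrite SubK.
Qed.
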